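(* Let $\mathcal{A}_n$ denote the $n$-th associahedron graph (defined in the context). Then the chromatic number satisfies $\chi(\mathcal{A}_n) = O(\log n)$; that is, there is an absolute constant $K$ such that $\chi(\mathcal{A}_n) \le K \log n$ for all $n \ge 4$.
   Context: For $n \ge 3$, consider the convex $n$-gon whose vertices are labelled $0,1,\ldots,n-1$ in clockwise order. The graph $\mathcal{A}_n$ (the 1-skeleton of the associahedron) has as vertices all triangulations of this polygon. A triangulation $T$ contains the boundary edges $01,12,\ldots,(n-1)0$; each non-boundary edge $e$ of $T$ is a diagonal of a unique quadrilateral formed by the two triangles of $T$ containing $e$, and flipping $e$ means replacing $e$ by the other diagonal of this quadrilateral. Two triangulations are adjacent in $\mathcal{A}_n$ if one is obtained from the other by a single flip. $\chi$ denotes the chromatic number. *)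

(* Defs.v *)
From mathcomp Require Import all_boot zify.

Set Implicit Arguments.
Unset Strict Implicit.
Unset Printing Implicit Defensive.

Local Open Scope nat_scope.

Record sgraph := SGraph {
  vertex : finType;
  adj : rel vertex;
  adj_sym : symmetric adj;
  adj_irrefl : irreflexive adj }.

Definition proper_coloring (G : sgraph) (k : nat)
    (f : {ffun vertex G -> 'I_k}) : bool :=
  [forall x, forall y, adj x y ==> (f x != f y)].

Definition colorable (G : sgraph) (k : nat) : bool :=
  [exists f : {ffun vertex G -> 'I_k}, proper_coloring f].

Lemma colorable_card (G : sgraph) : colorable G #|vertex G|.
Proof.
apply/existsP; exists [ffun x => enum_rank x].
apply/forallP => x; apply/forallP => y; apply/implyP => xy.
rewrite !ffunE; apply: contraTneq xy => /enum_rank_inj ->.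
by rewrite adj_irrefl.
Qed.

Definition chromatic_number (G : sgraph) : nat :=
  ex_minn (ex_intro (fun k => colorable G k) _ (colorable_card G)).

Section Polygon.
Variable n : nat.

(* An edge is the set of its two endpoints; the sides of the polygon count as
   edges.  Two edges of a convex polygon cross in their relative interiors iff
   their four endpoints are distinct and alternate around the polygon. *)
Definition is_edge (e : {set 'I_n}) : bool := #|e| == 2.

Definition crossing (e f : {set 'I_n}) : bool :=
  [exists a : 'I_n, exists b : 'I_n, exists c : 'I_n, exists d : 'I_n,
    [&& a < b, b < c, c < d &
        ((e == [set a; c]) && (f == [set b; d])) ||
        ((e == [set b; d]) && (f == [set a; c]))]].

Definition noncrossing (E : {set {set 'I_n}}) : bool :=
  [forall e in E, is_edge e] &&
  [forall e in E, forall f in E, ~~ crossing e f].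

(* A triangulation, given by its edge set (sides included), is an
   inclusion-maximal set of pairwise noncrossing edges. *)
Definition is_triangulation (T : {set {set 'I_n}}) : bool :=
  maxset noncrossing T.

Definition triangulation := {T : {set {set 'I_n}} | is_triangulation T}.

(* As the vertices are in convex position, any three vertices that are pairwise
   joined by edges of a triangulation bound one of its triangles. *)
Definition is_triangle (T : {set {set 'I_n}}) (a b c : 'I_n) : bool :=
  [&& [set a; b] \in T, [set b; c] \in T & [set a; c] \in T].

(* The crossing condition makes a, b, c, d distinct, with b and d on opposite
   sides of ac; hence abcd is the quadrilateral with diagonals ac and bd, and ac
   is not a side of the polygon. *)
Definition flip (S T : {set {set 'I_n}}) : bool :=
  [exists a : 'I_n, exists b : 'I_n, exists c : 'I_n, exists d : 'I_n,
    [&& crossing [set a; c] [set b; d],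
        is_triangle S a b c, is_triangle S a d c &
        T == [set b; d] |: (S :\ [set a; c])]].

Definition flip_adj (S T : triangulation) : bool :=
  flip (val S) (val T) || flip (val T) (val S).

Lemma flip_adj_sym : symmetric flip_adj.
Proof. by move=> S T; rewrite /flip_adj orbC. Qed.

Lemma flip_adj_irrefl : irreflexive flip_adj.
Proof.
move=> [T triT]; apply/negbTE/negP; rewrite /flip_adj orbb (_ : val _ = T) //.
case/existsP=> a /existsP[b] /existsP[c] /existsP[d].
case/and4P => cr /and3P[_ _ acT] _ /eqP eqT.
have bdT : [set b; d] \in T by rewrite eqT setU11.
have /andP[_ /forall_inP ncT] := maxsetp triT.
by have /forall_inP /(_ _ bdT) := ncT _ acT; rewrite cr.
Qed.

Definition associahedron : sgraph := SGraph flip_adj_sym flip_adj_irrefl.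

Lemma side_crossing (i : 'I_n) (f : {set 'I_n}) :
  2 < n -> ~~ crossing [set i; ordS i] f.
Proof.
move=> n_gt2; rewrite /crossing; apply/negP.
case/existsP=> a /existsP[b] /existsP[c] /existsP[d].
have side_eq (p q : 'I_n) : [set i; ordS i] = [set p; q] ->
    p < q -> q = p.+1 :> nat \/ p = 0 :> nat /\ q = n.-1 :> nat.
  move=> eqs; have := set21 p q; have := set22 p q.
  rewrite -eqs !inE -!val_eqE /= => Hq Hp.
  have := ltn_ord i; have := ltn_ord p; have := ltn_ord q.
  have [iS|iS] : i.+1 %% n = i.+1 /\ i.+1 < n \/ i.+1 %% n = 0 /\ i.+1 = n.
  - have := ltn_ord i; rewrite leq_eqVlt => /predU1P[e|lt].
      by right; rewrite e modnn.
    by left; rewrite modn_small.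
  - by case: iS Hp Hq => ->; lia.
  by case: iS Hp Hq => ->; lia.
have := ltn_ord d.
by move=> dn /and4P[ab bc cd] /orP[] /andP[/eqP /side_eq H _]; lia.
Qed.

Lemma side_in_triangulation (T : triangulation) (i : 'I_n) :
  2 < n -> [set i; ordS i] \in val T.
Proof.
case: T => T triT /= n_gt2; set s := [set i; ordS i].
have crossingC e f : crossing e f = crossing f e.
  apply: eq_existsb => a; apply: eq_existsb => b; apply: eq_existsb => c.
  apply: eq_existsb => d; rewrite orbC; do 3!congr (_ && _).
  by congr (_ || _); rewrite andbC.
have /andP[/forall_inP edT /forall_inP ncT] := maxsetp triT.
have ncs f : ~~ crossing s f by apply: side_crossing.
have s2 : is_edge s.
  rewrite /is_edge cards2 -val_eqE /=; have := ltn_ord i.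
  rewrite leq_eqVlt => /predU1P[e|lt]; first by rewrite e modnn; lia.
  by rewrite modn_small //; lia.
have nc_sT : noncrossing (s |: T).
  apply/andP; split; apply/forall_inP => e; rewrite in_setU1.
    by case/predU1P => [->|/edT].
  case/predU1P => [->|eT]; first by apply/forall_inP.
  apply/forall_inP => f; rewrite in_setU1 => /predU1P[->|fT].
    by rewrite crossingC.
  by have /forall_inP -> := ncT e eT.
by rewrite -(maxsetsup triT nc_sT (subsetUr _ _)) setU11.
Qed.

End Polygon.

(* Main.v *)
(* Write the vertices in binary with L ~ log2 n digits, and let the level of an
   edge be the top digit in which its endpoints differ.  A triangulation is
   coloured by the sum of the levels of its edges modulo L, together with one
   parity.  A flip ac -> bd with a < b < c < d leaves the first colour unchanged
   only if the two levels agree; then a, b lie in the left half and c, d in the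
   right half of one dyadic interval.
   The edges inside this interval that join its halves are linearly ordered by
   nesting; moving outwards, each step changes either the left or the right
   endpoint.  The flip swaps two consecutive steps of different kinds, so it
   changes by one the sum, over these edges, of the number of their left
   endpoints strictly further in; the second colour is the parity of the total
   of these numbers. *)
Require Import Defs.
From mathcomp Require Import all_boot zify.

Set Implicit Arguments.
Unset Strict Implicit.
Unset Printing Implicit Defensive.

(** * Binary levels of pairs of integers *)

(* The index of the top binary digit in which x and y differ, for
   x < y < 2 ^ L. *)
Fixpoint level (L x y : nat) : nat :=
  if L is L'.+1 then
    if y < 2 ^ L' then level L' x y
    else if 2 ^ L' <= x then level L' (x - 2 ^ L') (y - 2 ^ L')
    else L'
  else 0.

Lemma level_lt L x y : x < y -> y < 2 ^ L -> level L x y < L.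
Proof.
elim: L x y => [|L IH] x y xy; first by rewrite expn0; lia.
rewrite expnS /= => yL.
case: (ltnP y) => [yL'|yL']; first by apply: leqW; apply: IH.
by case: (leqP _ x) => // xL; apply: leqW; apply: IH; lia.
Qed.

(** At the top digit where the three are not all equal, [x] has 0 and [z] has 1. *)
Lemma level_max L x y z : x < y -> y < z -> z < 2 ^ L ->
  level L x z = maxn (level L x y) (level L y z).
Proof.
elim: L x y z => [|L IH] x y z xy yz; first by rewrite expn0; lia.
rewrite expnS /= => zL.
case: (ltnP z) => zL'; first by rewrite (ltn_trans yz zL'); apply: IH.
case: (leqP _ y) => yL.
  case: (leqP _ x) => xL; first by apply: IH; lia.
  by have := @level_lt L (y - 2 ^ L) (z - 2 ^ L); lia.
by have := @level_lt L x y xy yL; case: (leqP (2 ^ L) x); lia.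
Qed.

(** If the levels agreed, [y] would have 1 in that digit by [x < y] and 0 by [y < z]. *)
Lemma level_neq L x y z : x < y -> y < z -> z < 2 ^ L ->
  level L x y != level L y z.
Proof.
elim: L x y z => [|L IH] x y z xy yz; first by rewrite expn0; lia.
rewrite expnS /= => zL.
case: (ltnP z) => zL'; first by rewrite (ltn_trans yz zL'); apply: IH.
case: (leqP _ y) => yL.
  case: (leqP _ x) => xL; first by apply: IH; lia.
  by have := @level_lt L (y - 2 ^ L) (z - 2 ^ L); lia.
by have := @level_lt L x y xy yL; lia.
Qed.

Section Colouring.
Variables n L : nat.
Hypothesis n_le : n <= 2 ^ L.
Implicit Types (E C : {set {set 'I_n}}) (x y : 'I_n).

Let ord_lt x : x < 2 ^ L.
Proof. exact: leq_trans (ltn_ord x) n_le. Qed.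

Definition edge_pairs E : {set 'I_n * 'I_n} :=
  [set e : 'I_n * 'I_n | (e.1 < e.2) && ([set e.1; e.2] \in E)].

Definition left_ends E k : {set 'I_n} :=
  [set x : 'I_n | [exists y : 'I_n,
    [&& x < y, [set x; y] \in E & level L x y == k]]].

Definition level_sum E := \sum_(e in edge_pairs E) level L e.1 e.2.

(* Left ends lying in later dyadic intervals are counted too; they contribute
   the same amount to every edge joining the two halves of one interval. *)
Definition inner_ends E (e : 'I_n * 'I_n) :=
  #|[set x in left_ends E (level L e.1 e.2) | e.1 < x]|.

Definition inner_ends_sum E := \sum_(e in edge_pairs E) inner_ends E e.

Lemma set2_lt_inj x y x' y' :
  x < y -> x' < y' -> [set x; y] = [set x'; y'] -> (x, y) = (x', y').
Proof.
move=> xy xy' eqs; have := set21 x y; have := set22 x y.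
have := set21 x' y'; have := set22 x' y'.
rewrite -{1 2}eqs eqs !inE -!val_eqE /= => H1 H2 H3 H4.
by congr (_, _); apply: val_inj => /=; lia.
Qed.

Lemma edge_pairsU1 C x y : x < y ->
  edge_pairs ([set x; y] |: C) = (x, y) |: edge_pairs C.
Proof.
move=> xy; apply/setP => -[x' y']; rewrite !inE /=.
have [xy'|] /= := ltnP x' y'; last first.
  move=> yx; rewrite orbF; apply/esym/eqP => -[ex ey].
  by move: yx; rewrite ex ey; lia.
congr (_ || _); apply/eqP/eqP => [|[-> ->]//].
exact: set2_lt_inj.
Qed.

Lemma left_endsU1 C k x y : x < y ->
  (level L x y = k -> x \in left_ends C k) ->
  left_ends ([set x; y] |: C) k = left_ends C k.
Proof.
move=> xy xC; apply/setP => z; rewrite !inE.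
apply/existsP/existsP => -[t /and3P[zt ztC lk]]; last first.
  by exists t; rewrite zt in_setU1 ztC orbT.
move: ztC lk; rewrite in_setU1 => /predU1P[ztE|ztC lk]; last first.
  by exists t; rewrite zt ztC.
case: (set2_lt_inj zt xy ztE) => -> -> /eqP /xC.
by rewrite inE => /existsP.
Qed.

(** * Effect of one flip; [C] holds the edges common to both triangulations *)

Section Flip.
Variables (C : {set {set 'I_n}}) (a b c d : 'I_n).
Hypotheses (ab : a < b) (bc : b < c) (cd : c < d).
Hypotheses (abC : [set a; b] \in C) (bcC : [set b; c] \in C).
Hypotheses (adC : [set a; d] \in C).
Hypotheses (acC : [set a; c] \notin C) (bdC : [set b; d] \notin C).
Hypothesis ncC : noncrossing C.

Let ac : a < c. Proof. exact: ltn_trans bc. Qed.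
Let bd : b < d. Proof. exact: ltn_trans cd. Qed.

Lemma level_sum_flip :
  level_sum ([set a; c] |: C) = level L a c + level_sum C /\
  level_sum ([set b; d] |: C) = level L b d + level_sum C.
Proof.
rewrite /level_sum !edge_pairsU1 // !big_setU1 // inE /= negb_and;
by rewrite ?acC ?bdC orbT.
Qed.

Hypothesis level_eq : level L a c = level L b d.

Lemma level_outer : level L a d = level L a c.
Proof.
by have := level_max ab bd (ord_lt d); have := level_max ab bc (ord_lt c); lia.
Qed.

(** As [level L c d] differs from [level L a c = level L b d], the maximum giving [level L b d] is
    attained on [bc]. *)
Lemma level_inner : level L b c = level L a c.
Proof.
have := level_max ab bc (ord_lt c); have := level_max bc cd (ord_lt d).
have := level_neq ac cd (ord_lt d); lia.
Qed.

Lemma level_side : level L a b < level L a c.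
Proof.
have := level_max ab bc (ord_lt c); have := level_neq ab bc (ord_lt c).
have := level_inner; lia.
Qed.

Lemma left_ends_b : b \in left_ends C (level L a c).
Proof.
by rewrite inE; apply/existsP; exists c; rewrite bc bcC level_inner eqxx.
Qed.

(** The left end of the added diagonal is already one in [C]: [a] through [ad], [b] through [bc]. *)
Lemma left_ends_flip k :
  left_ends ([set a; c] |: C) k = left_ends C k /\
  left_ends ([set b; d] |: C) k = left_ends C k.
Proof.
split; apply: left_endsU1 => // <-; last by rewrite -level_eq left_ends_b.
rewrite inE; apply/existsP; exists d.
by rewrite (ltn_trans ab bd) adC level_outer eqxx.
Qed.

(* The edge ab separates the vertices strictly between a and b from the right
   half of the dyadic interval. *)
Lemma left_ends_between x :
  a < x -> x < b -> x \notin left_ends C (level L a c).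
Proof.
move=> ax xb; rewrite inE; apply/existsP => -[y /and3P[xy xyC /eqP lev_xy]].
(* If [y <= b], the level of [xy] is at most that of [ab], hence too small; otherwise [xy] crosses
   [ab]. *)
have [yb|by_] := leqP y b.
  have := level_side; rewrite -lev_xy (level_max ax xb (ord_lt b)).
  have [->|ne] := eqVneq y b; first by lia.
  have yb' : y < b by rewrite ltn_neqAle yb andbT.
  by rewrite (level_max xy yb' (ord_lt b)); lia.
case/andP: ncC => _ /forall_inP/(_ _ abC)/forall_inP/(_ _ xyC)/negP; apply.
apply/existsP; exists a; apply/existsP; exists x.
by apply/existsP; exists b; apply/existsP; exists y; rewrite ax xb by_ !eqxx.
Qed.

(** The left ends beyond [a] are those beyond [b] together with [b] itself. *)
Lemma inner_ends_flip : inner_ends C (a, c) = (inner_ends C (b, d)).+1.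
Proof.
rewrite /inner_ends /= -level_eq.
suff -> : [set x in left_ends C (level L a c) | a < x] =
    b |: [set x in left_ends C (level L a c) | b < x].
  by rewrite cardsU1 !inE ltnn andbF.
apply/setP => x; rewrite [in LHS]inE [in RHS]inE in_set1 [in RHS]inE.
have [->|xb] := eqVneq x b; first by rewrite left_ends_b ab.
have [bx|xb'] := ltnP b x; first by rewrite (ltn_trans ab bx).
rewrite andbF; apply/negP => /andP[xA ax].
have xb2 : x < b by rewrite ltn_neqAle xb xb'.
by move: xA; apply/negP; apply: left_ends_between.
Qed.

Lemma inner_ends_sum_flip :
  inner_ends_sum ([set a; c] |: C) = (inner_ends_sum ([set b; d] |: C)).+1.
Proof.
have innerE E e : (forall k, left_ends E k = left_ends C k) ->
    inner_ends E e = inner_ends C e by rewrite /inner_ends => ->.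
rewrite /inner_ends_sum !edge_pairsU1 // !big_setU1; first last.
- by rewrite inE /= negb_and acC orbT.
- by rewrite inE /= negb_and bdC orbT.
rewrite /= !innerE => [|k|k]; try by case: (left_ends_flip k).
rewrite inner_ends_flip addSn; congr (_ + _).+1.
by apply: eq_bigr => e _; rewrite !innerE // => k; case: (left_ends_flip k).
Qed.

End Flip.

(** * The colouring and its properness *)

Definition colour E : nat * bool := (level_sum E %% L, odd (inner_ends_sum E)).

(** Levels are below [L], so equal first colours force equal levels; the parities then differ. *)
Lemma colour_flip C (a b c d : 'I_n) : a < b -> b < c -> c < d ->
    [set a; b] \in C -> [set b; c] \in C -> [set a; d] \in C ->
    [set a; c] \notin C -> [set b; d] \notin C -> noncrossing C ->
  colour ([set a; c] |: C) != colour ([set b; d] |: C).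
Proof.
move=> ab bc cd abC bcC adC acC bdC ncC; apply/eqP => -[].
have [-> ->] := level_sum_flip ab bc cd acC bdC.
move/eqP; rewrite eqn_modDr.
rewrite !modn_small ?level_lt ?ord_lt ?(ltn_trans ab bc) ?(ltn_trans bc cd) //.
move/eqP=> lev_eq.
rewrite (inner_ends_sum_flip ab bc cd abC bcC adC acC bdC ncC lev_eq) /=.
by case: odd.
Qed.

Lemma colour_neq (S T : triangulation n) :
  flip (val S) (val T) -> colour (val S) != colour (val T).
Proof.
case: S T => [S triS] [T triT] /=.
have /andP[/forall_inP edS /forall_inP ncS] := maxsetp triS.
case/existsP=> a /existsP[b] /existsP[c] /existsP[d].
case/and4P=> cr /and3P[abS bcS acS] /and3P[adS dcS _] /eqP eqT.
set C := S :\ [set a; c] in eqT.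
have defS : S = [set a; c] |: C by rewrite setD1K.
have acC : [set a; c] \notin C by rewrite setD11.
have bdC : [set b; d] \notin C.
  rewrite !inE negb_and; apply/orP; right.
  by apply/negP => /(forall_inP (ncS _ acS)); rewrite cr.
have ncC : noncrossing C.
  apply/andP; split; apply/forall_inP => e /setD1P[_ eS]; first exact: edS.
  by apply/forall_inP => f /setD1P[_ fS]; apply: (forall_inP (ncS _ eS)).
(* The sides of the quadrilateral survive the removal of [ac], each having an end off [ac]. *)
have side x y : x \in [set a; c] -> y \in [set b; d] -> y \notin [set a; c] ->
    [set x; y] \in C.
  move=> xac ybd yac; rewrite in_setD1; apply/andP; split.
    by apply: contraNneq yac => <-; rewrite set22.
  move: xac ybd; rewrite !in_set2.
  by case/orP=> /eqP-> /orP[] /eqP-> //; rewrite setUC.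
rewrite defS eqT; case/existsP: cr => p /existsP[q] /existsP[r] /existsP[s].
case/and4P=> pq qr rs.
have qs : q < s by apply: ltn_trans rs.
have pr : p < r by apply: ltn_trans qr.
have notin (x y z : 'I_n) :
    (x < y) || (y < x) -> (x < z) || (z < x) -> x \notin [set y; z].
  by move=> xy xz; rewrite in_set2 -!val_eqE /=; lia.
case/orP=> /andP[/eqP eac /eqP ebd]; rewrite eac ebd in side acC bdC *.
  apply: colour_flip => //;
    try by apply: side; rewrite ?set21 ?set22 // notin //; lia.
  by rewrite setUC; apply: side; rewrite ?set21 ?set22 // notin //; lia.
(* Here the flip goes from [qs] to [pr], the reverse of [colour_flip]. *)
rewrite eq_sym.
apply: colour_flip => //;
  try by apply: side; rewrite ?set21 ?set22 // notin //; lia.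
  by rewrite setUC; apply: side; rewrite ?set21 ?set22 // notin //; lia.
by rewrite setUC; apply: side; rewrite ?set21 ?set22 // notin //; lia.
Qed.

Lemma colorable_associahedron : 0 < L -> colorable (associahedron n) (L * 2).
Proof.
move=> L_gt0.
pose K : finType := ('I_L * bool)%type.
pose f (T : triangulation n) : K :=
  (Ordinal (ltn_pmod (level_sum (val T)) L_gt0), odd (inner_ends_sum (val T))).
have cardK : #|K| = L * 2 by rewrite card_prod card_ord card_bool.
apply/existsP; exists [ffun T => cast_ord cardK (enum_rank (f T))].
apply/forallP => S; apply/forallP => T; apply/implyP => ST.
rewrite !ffunE; apply/eqP => /cast_ord_inj /enum_rank_inj [eq1 eq2].
have eqST : colour (val S) = colour (val T) by rewrite /colour eq1 eq2.
by case/orP: ST => /colour_neq; rewrite eqST eqxx.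
Qed.

End Colouring.

(** * The logarithmic bound *)

Lemma chromatic_number_le (G : sgraph) k :
  colorable G k -> chromatic_number G <= k.
Proof. by rewrite /chromatic_number; case: ex_minnP => m _; apply. Qed.

From mathcomp Require Import all_order all_algebra.
From mathcomp Require Import all_classical all_reals all_analysis.
Import Order.TTheory GRing.Theory Num.Theory.

Theorem theorem1 (R : realType) :
  exists K : R, forall n : nat, (4 <= n)%N ->
    ((chromatic_number (associahedron n))%:R <= K * ln (n%:R))%R.
Proof.
have ln2_gt0 : (0 < ln 2 :> R)%R by rewrite ln_gt0 // ltr1n.
(* With [l] the integer part of log2 n, at least 1, the 2(l + 1) colours number at most 4l, and l ln
   2 is at most ln n. *)
exists (4 / ln 2)%R => n n_ge4.
set l := trunc_log 2 n.
have l_gt0 : 0 < l by rewrite /l trunc_log_gt0; lia.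
have n_lt : n < 2 ^ l.+1 by apply: trunc_log_ltn.
have l_le : 2 ^ l <= n by apply: trunc_logP; lia.
have chi_le : chromatic_number (associahedron n) <= 4 * l.
  have col := colorable_associahedron (ltnW n_lt) (ltn0Sn l).
  by apply: leq_trans (chromatic_number_le col) _; lia.
have ln_le : (ln 2 *+ l <= ln n%:R :> R)%R.
  by rewrite -lnXn // -natrX ler_ln ?posrE ?ltr0n ?expn_gt0 ?ler_nat //; lia.
apply: (@le_trans _ _ (4 * l)%:R%R); first by rewrite ler_nat.
rewrite natrM -mulrA ler_wpM2l // mulrC ler_pdivlMr //.
by rewrite mulr_natl.
Qed.
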